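(* Let $p$ be prime and $q=p^h$. Suppose that $S$ is an integer multiset of points in $\mathrm{AG}(2,q)$ that is inequidistributed from exactly three directions. Then there exists an affine transformation $\varphi$ of $\mathrm{AG}(2,q)$ such that either $$\mu_{S^\varphi}\in\mathbb Z\mathcal L(\{(\infty),(0),(1)\})$$ or $$\mu_{S^\varphi}\in\mu_{\mathrm{Lift}(K)}+\mathbb Z\mathcal L(\{(\infty),(0),(1)\}).$$
   Context: $\mathrm{AG}(2,q)$ is the Desarguesian affine plane with point set $\mathbb F_q^2$ and line set $\mathcal L$. Its directions are $(d)$, $d\in\mathbb F_q\cup\{\infty\}$: for $d\in\mathbb F_q$ the lines with direction $(d)$ are $Y=dX+b$, and the lines with direction $(\infty)$ are $X=a$; $\operatorname{dir}(\ell)$ denotes the direction of a line $\ell$. An integer multiset $S$ of points is given by a multiplicity function $\mu_S:\mathbb F_q^2\to\mathbb Z$ (negative values allowed). For a line $\ell$, $|S\cap\ell|=\sum_{P\in\ell}\mu_S(P)$. $S$ is equidistributed from $(d)$ if $|S\cap\ell|$ is the same for all lines $\ell$ with direction $(d)$, and inequidistributed from $(d)$ otherwise. For an affine transformation $\varphi$ of $\mathrm{AG}(2,q)$ (a map $v\mapsto Mv+b$ with $M\in\mathrm{GL}(2,q)$, $b\in\mathbb F_q^2$), $S^\varphi$ is the image multiset, $\mu_{S^\varphi}=\mu_S\circ\varphi^{-1}$. For a line $\ell$, $\mu_\ell:\mathbb F_q^2\to\{0,1\}$ is its characteristic function. For a set $D$ of directions, $\mathbb Z\mathcal L(D)=\left\{\sum_{\ell\in\mathcal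 L,\ \operatorname{dir}(\ell)\in D}c_\ell\mu_\ell : c_\ell\in\mathbb Z\right\}$. Let $\operatorname{Tr}:\mathbb F_q\to\mathbb F_p$ be the absolute trace, let $\nu:\mathbb F_p\to\{0,\dots,p-1\}$ be the natural choice of integer representatives, and let $K=\{(x,y)\in\mathbb F_p^2:\nu(x)<\nu(y)\}$. Then $\mathrm{Lift}(K)$ is the point set of $\mathrm{AG}(2,q)$ with $\mu_{\mathrm{Lift}(K)}(x,y)=\mu_K(\operatorname{Tr}(x),\operatorname{Tr}(y))$, i.e. $\mathrm{Lift}(K)=\{(x,y)\in\mathbb F_q^2:\nu(\operatorname{Tr}(x))<\nu(\operatorname{Tr}(y))\}$. *)

(* Defs.v *)
From HB Require Import structures.
From mathcomp Require Import all_boot all_order all_algebra all_fingroup all_field.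

Set Implicit Arguments.
Unset Strict Implicit.
Unset Printing Implicit Defensive.

Import GRing.Theory.
Local Open Scope ring_scope.

Notation point F := 'cV[F]_2 (only parsing).
Notation xcoord P := (P 0 0) (only parsing).
Notation ycoord P := (P 1 0) (only parsing).

(* [Some d] is the direction (d) and [None] is the direction (oo). *)
Notation direction F := (option F) (only parsing).

(* [(Some d, b)] encodes the line Y = dX + b and [(None, a)] the line X = a;
   by [points_inj] below, distinct codes are distinct lines. *)
Notation line F := (option F * F)%type (only parsing).

Notation multiset F := {ffun point F -> int} (only parsing).

Section AffinePlane.
Variable F : finFieldType.
Implicit Types (P v : point F) (l : line F) (d : direction F).
Implicit Types (D : {set direction F}) (S : multiset F).

Definition dir l : direction F := l.1.

Definition points l : {set point F} :=
  match l with
  | (Some d, b) => [set P : point F | ycoord P == d * xcoord P + b]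
  | (None, a) => [set P : point F | xcoord P == a]
  end.

Definition mu_set (A : {set point F}) : multiset F := [ffun P => (P \in A)%:R].

Definition meet_size S l : int := \sum_(P in points l) S P.

Definition equidistributed S d : bool :=
  [forall l1 : line F, forall l2 : line F,
     (dir l1 == d) && (dir l2 == d) ==> (meet_size S l1 == meet_size S l2)].

Definition inequidistributed S d : bool := ~~ equidistributed S d.

Definition is_affine (phi : {perm point F}) : Prop :=
  exists (M : 'M[F]_2) (b : point F),
    M \in unitmx /\ forall v, phi v = M *m v + b.

Definition image_multiset S (phi : {perm point F}) : multiset F :=
  [ffun P => S ((phi^-1)%g P)].

Definition in_ZL D S : Prop :=
  exists c : line F -> int,
    S = [ffun P => \sum_(l | dir l \in D) c l * mu_set (points l) P].

Definition trace_sum (p h : nat) (x : F) : F := \sum_(i < h) x ^+ (p ^ i).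

(* The element of 'F_p whose image in F is [trace_sum p h x]; it exists and
   is unique when #|F| = p ^ h, by [absTrE] and [natFp_inj]. *)
Definition absTr (p h : nat) (x : F) : 'F_p :=
  odflt 0 [pick a : 'F_p | (val a)%:R == trace_sum p h x].

Definition Lift (p h : nat) (A : {set point 'F_p}) : {set point F} :=
  [set P : point F | map_mx (absTr p h) P \in A].

End AffinePlane.

Arguments absTr {F} p h x.
Arguments Lift F p h A : clear implicits.

Definition nu (p : nat) (a : 'F_p) : nat := val a.

Definition setK (p : nat) : {set point 'F_p} :=
  [set P : point 'F_p | (nu (xcoord P) < nu (ycoord P))%N].

Lemma points_inj (F : finFieldType) : injective (@points F).
Proof.
have E (P : F * F) : exists v : point F, xcoord v = P.1 /\ ycoord v = P.2.
  by exists (\col_i if i == 0 then P.1 else P.2); rewrite !mxE.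
move=> [[d|] b] [[d'|] b'] /setP eqp.
- have [v [xv yv]] := E (0, b); have [w [xw yw]] := E (1, d + b).
  have := eqp v; have := eqp w; rewrite !inE xv yv xw yw /= !mulr0 !add0r !mulr1.
  rewrite !eqxx => /esym/eqP h /esym/eqP h2; move: h; rewrite h2.
  by move/addIr ->.
- have [v [xv yv]] := E (b' + 1, d * (b' + 1) + b).
  have := eqp v; rewrite !inE xv yv /= eqxx => /esym.
  by rewrite -subr_eq0 addrAC subrr add0r oner_eq0.
- have [v [xv yv]] := E (b + 1, d' * (b + 1) + b').
  have := eqp v; rewrite !inE xv yv /= eqxx.
  by rewrite -subr_eq0 addrAC subrr add0r oner_eq0.
- have [v [xv yv]] := E (b, 0).
  by have := eqp v; rewrite !inE xv /= eqxx => /esym/eqP ->.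
Qed.

Section TraceCheck.
Variables (F : finFieldType) (p h : nat).
Hypotheses (pr_p : prime p) (cardF : #|F| = (p ^ h)%N).

Let pcharF : p \in [pchar F].
Proof. exact: card_finPcharP cardF pr_p. Qed.

Lemma natFp_inj : injective (fun a : 'F_p => (val a)%:R : F).
Proof.
suff H (a b : 'F_p) : (a <= b)%N -> (val a)%:R = (val b)%:R :> F -> a = b.
  by move=> a b; case/orP: (leq_total a b) => /H// {}H /esym/H.
move=> leab /esym/eqP; rewrite -subr_eq0 -natrB // -(dvdn_pcharf pcharF).
have ltb : (b - a < p)%N.
  by rewrite (leq_ltn_trans (leq_subr _ _)) // -[X in (_ < X)%N](Fp_cast pr_p).
case: (posnP (b - a)) => [/eqP|ba_gt0 /(dvdn_leq ba_gt0)]; last first.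
  by rewrite leqNgt ltb.
by rewrite subn_eq0 => leba _; apply/val_inj/eqP; rewrite eqn_leq leab.
Qed.

Lemma absTrE (x : F) : (val (absTr p h x))%:R = trace_sum p h x.
Proof.
rewrite /absTr; case: pickP => [a /eqP //|no].
set s := trace_sum p h x.
have sp : s ^+ p = s.
  rewrite -(pFrobenius_autE pcharF) /s /trace_sum rmorph_sum /=.
  case: h cardF => [|k] ck; first by rewrite !big_ord0.
  rewrite big_ord_recr [RHS]big_ord_recl /= expn0 expr1 addrC.
  rewrite pFrobenius_autE -exprM -expnSr -ck expf_card; congr (_ + _).
  by apply: eq_bigr => i _; rewrite pFrobenius_autE -exprM -expnSr.
have p_gt1 := prime_gt1 pr_p.
have szq : size ('X^p - 'X : {poly F}) = p.+1.
  by rewrite size_polyDl size_polyXn // size_polyN size_polyX ltnS.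
have := @max_poly_roots F ('X^p - 'X) (s :: [seq (val a)%:R | a : 'F_p]).
rewrite -size_poly_eq0 szq /= size_map -cardE card_Fp // ltnn => H.
suff: false by []. apply: H => //.
  rewrite rootE !hornerE sp subrr eqxx /=; apply/allP => _ /mapP[a _ ->].
  rewrite rootE !hornerE -[X in X - _](pFrobenius_autE pcharF).
  by rewrite rmorph_nat subrr.
rewrite map_inj_uniq ?enum_uniq ?andbT; last exact: natFp_inj.
by apply/mapP => -[a _ es]; have := no a; rewrite -/s es eqxx.
Qed.

End TraceCheck.

(* Main.v *)
From HB Require Import structures.
Require Import Defs.
From mathcomp Require Import all_boot all_order all_algebra all_fingroup all_field.
From mathcomp Require Import ring zify.
Import GRing.Theory.
Local Open Scope ring_scope.

(** Summing [|S n l|] over the lines [l] through [P] gives [q S(P) + |S|]; lines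
    in an equidistributed direction contribute a constant, so after sending the
    three exceptional directions to (oo), (0), (1) one has
    [q S(x, y) = A x + B y + C (y - x) + k] with integer [A], [B], [C], [k].
    Modulo [q], [C - C 0] is then additive, hence [q / p] times an additive map
    [F -> F_p], that is, [q / p] times some [z |-> - Tr (l z)].  If [l = 0],
    dividing by [q] shows that [S] is an integral combination of lines.
    Otherwise scaling the plane by [l] reduces to [l = 1], and the remainder
    [(nu (Tr y) - nu (Tr x) + nu (Tr (x - y))) / p] is the carry
    [nu (Tr x) < nu (Tr y)], the indicator of [Lift(K)]. *)

(** * Additive maps to the prime field, and the trace *)

(** Every fibre is a translate of the kernel by a multiple of [x0], so the [p] fibres have equal
    size. *)
Lemma card_additive_fiber {p : nat} {U : finZmodType} (g : {additive U -> 'F_p})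
    (x0 : U) (c : 'F_p) :
  prime p -> g x0 != 0 -> (#|[set x | g x == c]| * p)%N = #|U|.
Proof.
move=> p_pr gx0.
have same (b : 'F_p) : #|[set x | g x == b]| = #|[set x | g x == 0]|.
  pose z := x0 *+ (b / g x0 : 'F_p).
  have gz : g z = b by rewrite raddfMn -mulr_natl natr_Zp divfK.
  rewrite -[RHS](card_preimset _ (addIr (- z))).
  by apply: eq_card => x; rewrite !inE raddfB gz subr_eq0.
rewrite -[#|U|]sum1_card (partition_big g xpredT) //= same.
under eq_bigr => b _ do rewrite sum1dep_card same.
by rewrite sum_nat_const card_Fp // mulnC.
Qed.

(* Count the pairs (l, x) with [chi x = g (l * x)]: summing over x first gives
   more than the q^2/p obtained if [chi] differed from every [g (l * -)]. *)
Lemma additive_dual {p : nat} {F : finFieldType} (g chi : {additive F -> 'F_p})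
    (x0 : F) :
  prime p -> g x0 != 0 -> exists l : F, forall x, chi x = g (l * x).
Proof.
move=> p_pr gx0.
case: (boolP [exists l, [forall x, chi x == g (l * x)]]) => [|/existsPn no].
  by case/existsP=> l /forallP eq_l; exists l => x; apply/eqP.
have count_x l : (#|[set x | chi x == g (l * x)%R]| * p)%N = #|F|.
  have Dz : zmod_morphism (fun x => chi x - g (l * x)).
    by move=> x y; rewrite /= mulrBr !raddfB /=; ring.
  pose D := GRing.isZmodMorphism.Build F 'F_p (fun x => chi x - g (l * x)) Dz.
  pose d : {additive F -> 'F_p} := HB.pack (fun x => chi x - g (l * x)) D.
  have /forallPn[y dy] := no l.
  rewrite -(card_additive_fiber d y 0 p_pr) /=; last by rewrite subr_eq0.
  by congr (_ * _)%N; apply: eq_card => x; rewrite !inE subr_eq0.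
have count_l x : x != 0 -> (#|[set l | chi x == g (l * x)%R]| * p)%N = #|F|.
  move=> x_nz; rewrite -(card_additive_fiber g x0 (chi x) p_pr gx0).
  rewrite -[in RHS](card_preimset _ (mulIf x_nz)).
  by congr (_ * _)%N; apply: eq_card => l; rewrite !inE eq_sym.
have : (\sum_(l : F) #|[set x | chi x == g (l * x)%R]| * p =
        \sum_(x : F) #|[set l | chi x == g (l * x)%R]| * p)%N.
  rewrite -!big_distrl /=; congr (_ * _)%N.
  under eq_bigr => l _ do rewrite -sum1dep_card big_mkcond /=.
  rewrite exchange_big /=; apply: eq_bigr => x _.
  by rewrite -big_mkcond sum1dep_card.
(* Each [l], and each [x != 0], contributes [q]; deleting the index 0 from both sums leaves
   [q = q * p], which is absurd. *)
rewrite (eq_bigr _ (fun l _ => count_x l)) [LHS](bigD1 0) //=.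
rewrite [RHS](bigD1 0) //= (eq_bigr _ count_l) => /eqP; rewrite eqn_add2r.
have -> : #|[set l : F | chi 0 == g (l * 0)%R]| = #|F|.
  by rewrite -cardsT; apply: eq_card => l; rewrite !inE mulr0 !raddf0 eqxx.
have F_gt0 : (0 < #|F|)%N by apply/card_gt0P; exists 0.
by rewrite -[X in X == _]muln1 eqn_pmul2l // eq_sym eqn_leq leqNgt prime_gt1.
Qed.

(** As ['F_p] embeds in [F], it is enough to treat [trace_sum], a sum of iterates of Frobenius. *)
Lemma absTr_additive {p h : nat} {F : finFieldType} :
  prime p -> #|F| = (p ^ h)%N -> zmod_morphism (@absTr F p h).
Proof.
move=> p_pr cardF.
have pcharF : p \in [pchar F] := card_finPcharP cardF p_pr.
suff addTr : {morph @absTr F p h : x y / x + y}.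
  by move=> x y; apply/eqP; rewrite eq_sym subr_eq -addTr subrK.
move=> x y; apply: (natFp_inj p_pr cardF); rewrite absTrE //.
have -> : (val (absTr p h x + absTr p h y))%:R =
          (val (absTr p h x))%:R + (val (absTr p h y))%:R :> F.
  rewrite /= [X in (_ %% X)%N]Fp_cast // -natrD.
  by rewrite [in RHS](divn_eq (_ + _) p) natrD natrM (pcharf0 pcharF) mulr0 add0r.
rewrite !absTrE // /trace_sum -big_split /=; apply: eq_bigr => i _.
by rewrite exprDn_pchar // pnatX (pnatE _ p_pr) pcharF.
Qed.

(** The trace is a polynomial of degree [p ^ (h - 1)], too small to vanish at all [p ^ h]
    elements. *)
Lemma absTr_neq0 {p h : nat} {F : finFieldType} :
  prime p -> #|F| = (p ^ h)%N -> exists x : F, absTr p h x != 0.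
Proof.
move=> p_pr cardF; apply/existsP; apply: contraT => /existsPn no.
have p_gt1 := prime_gt1 p_pr.
case: h cardF no => [|k] cardF no.
  by have := card_finNzRing_gt1 F; rewrite cardF expn0.
pose P : {poly F} := \sum_(i < k.+1) 'X^(p ^ i).
have szP : size P = (p ^ k).+1.
  rewrite /P big_ord_recr /= addrC size_polyDl ?size_polyXn // ltnS.
  apply: (leq_trans (size_sum _ _ _)); apply/bigmax_leqP => i _.
  by rewrite size_polyXn ltn_exp2l.
have P_nz : P != 0 by rewrite -size_poly_eq0 szP.
have := @max_poly_roots F P (enum F) P_nz.
rewrite szP enum_uniq -cardE cardF ltnS leqNgt ltn_exp2l // ltnSn => H.
suff: false by []. apply: H => //; apply/allP => x _.
rewrite rootE /P horner_sum; under eq_bigr do rewrite hornerXn.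
have := absTrE p_pr cardF x; rewrite /trace_sum => <-.
by have := no x; rewrite negbK => /eqP ->.
Qed.

(** * Carries and integer functions modulo [q] *)

(** Subtracting residues borrows [p] exactly when [nu a < nu b]. *)
Lemma nu_carry {p : nat} (a b : 'F_p) : prime p ->
  (nu b)%:Z - (nu a)%:Z + (nu (a - b))%:Z = p%:Z * (nu a < nu b)%N%:R.
Proof.
move=> p_pr; have lt_p (c : 'F_p) : (val c < p)%N.
  by rewrite -[X in (_ < X)%N](Fp_cast p_pr) ltn_ord.
have -> : nu (a - b) = ((val a + (p - val b)) %% p)%N.
  by rewrite /nu /= modnDmr [X in (_ %% X)%N]Fp_cast // [X in (X - _)%N]Fp_cast.
rewrite /nu; move: (lt_p a) (lt_p b); move: (val a) (val b) => {}a {}b lt_a lt_b.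
case: ltnP => [lt_ab|le_ba] /=; first by rewrite modn_small; lia.
have -> : (a + (p - b) = (a - b) + p)%N by lia.
by rewrite modnDr modn_small; lia.
Qed.

(* [C - C 0] is additive modulo [r * p]; as [p] kills [U] it is [r] times some
   [e] that is additive modulo [p], and [chi] is [- e]. *)
Lemma three_function_sum {p r : nat} {U : zmodType} (S : U -> U -> int)
    (A B C : U -> int) (k : int) :
    prime p -> (0 < r)%N -> (forall u : U, u *+ p = 0) ->
    (forall x y, (r * p)%:Z * S x y = A x + B y + C (y - x) + k) ->
  exists (chi : {additive U -> 'F_p}) (a b c : U -> int), forall x y,
    S x y = (nu (chi x) < nu (chi y))%N%:R + a x + b y + c (y - x).
Proof.
move=> p_pr r_gt0 pU0 eqS; set q : int := (r * p)%:Z in eqS.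
have qE : q = r%:Z * p%:Z by rewrite /q PoszM.
have r_nz : r%:Z != 0 by lia.
have p_nz : p%:Z != 0 by have := prime_gt0 p_pr; lia.
have E x y : (q %| A x + B y + C (y - x) + k)%Z by rewrite -eqS dvdz_mulr.
pose D z := C z - C 0.
(* The mixed second difference of [E], with [x] in [{- z, 0}] and [y] in [{0, w}], eliminates [A],
   [B] and [k]. *)
have addD z w : (q %| D (z + w) - D z - D w)%Z.
  have := E (- z) w; have := E (- z) 0; have := E 0 w; have := E 0 0.
  rewrite /D !subr0 !opprK add0r (addrC w) => E1 E2 E3 E4.
  have -> : C (z + w) - C 0 - (C z - C 0) - (C w - C 0) =
    (A (- z) + B w + C (z + w) + k) + (A 0 + B 0 + C 0 + k)
    - (A 0 + B w + C w + k) - (A (- z) + B 0 + C z + k) by ring.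
  by do 2!apply: rpredB => //; apply: rpredD.
have mulD z n : (q %| D (z *+ n) - D z *+ n)%Z.
  elim: n => [|n IHn]; first by rewrite /D !mulr0n !subrr.
  have -> : D (z *+ n.+1) - D z *+ n.+1 =
    (D (z + z *+ n) - D z - D (z *+ n)) + (D (z *+ n) - D z *+ n).
    by rewrite !mulrS; ring.
  by apply: rpredD.
(* Since [D (z *+ p) = D 0 = 0], [q = r * p] divides [p * D z]. *)
have rD z : (r %| D z)%Z.
  rewrite -(dvdz_mul2r p_nz) -qE.
  have := mulD z p; rewrite pU0 {1}/D subrr sub0r rpredN.
  by rewrite -mulr_natr natz.
pose e z := (D z %/ r)%Z.
have eE z : D z = r%:Z * e z by rewrite mulrC divzK.
have dvdp u : (p %| u)%Z = (u%:~R == 0 :> 'F_p) := dvdz_pcharf (pchar_Fp p_pr) u.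
have e_sub : zmod_morphism (fun z => - (e z)%:~R : 'F_p).
  move=> x y; apply/eqP; rewrite -subr_eq0.
  have := addD (x - y) y; rewrite subrK !eE qE.
  have -> : r%:Z * e x - r%:Z * e (x - y) - r%:Z * e y =
    r%:Z * (e x - e (x - y) - e y) by ring.
  rewrite dvdz_mul2l // dvdp !rmorphB /= => /eqP e0; apply/eqP.
  by rewrite -[RHS]e0; ring.
pose chi : {additive U -> 'F_p} :=
  HB.pack (fun z : U => - (e z)%:~R : 'F_p) (GRing.isZmodMorphism.Build _ _ _ e_sub).
have chiE z : chi z = - (e z)%:~R by [].
(* The integer lift [t] of [chi] gives corrections modulo [q]: [r * t (- z)] for [C] and then,
   setting [x = 0] or [y = 0], [r * t y] for [B] and [- r * t x] for [A]. *)
pose t z : int := (nu (chi z))%:Z.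
have tE z : (t z)%:~R = chi z by rewrite /t -[RHS]natr_Zp.
have dC z : (q %| (C z - C 0 - r%:Z * t (- z))%R)%Z.
  rewrite -/(D z) eE -mulrBr qE dvdz_mul2l // dvdp rmorphB /= tE (raddfN chi).
  by rewrite chiE opprK subrr.
have dB y : (q %| (B y - B 0 - r%:Z * t y)%R)%Z.
  have tN : (q %| r%:Z * (t y + t (- y)))%Z.
    by rewrite qE dvdz_mul2l // dvdp rmorphD /= !tE (raddfN chi) subrr.
  have -> : B y - B 0 - r%:Z * t y =
    (A 0 + B y + C (y - 0) + k) - (A 0 + B 0 + C (0 - 0) + k)
    - (C y - C 0 - r%:Z * t (- y)) - r%:Z * (t y + t (- y)).
    by rewrite !subr0; ring.
  by do 3!apply: rpredB => //.
have dA x : (q %| (A x - A 0 + r%:Z * t x)%R)%Z.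
  have -> : A x - A 0 + r%:Z * t x =
    (A x + B 0 + C (0 - x) + k) - (A 0 + B 0 + C (0 - 0) + k)
    - (C (- x) - C 0 - r%:Z * t (- - x)).
    by rewrite !subr0 sub0r opprK; ring.
  by do 2!apply: rpredB => //.
(* The corrections add up to [r * (t y - t x + t (x - y))], to which [nu_carry] applies; the
   constant left over is put into [c]. *)
exists chi, (fun x => ((A x - A 0 + r%:Z * t x)%R %/ q)%Z).
exists (fun y => ((B y - B 0 - r%:Z * t y)%R %/ q)%Z).
exists (fun z => ((C z - C 0 - r%:Z * t (- z))%R %/ q)%Z
                 + ((A 0 + B 0 + C (0 - 0) + k)%R %/ q)%Z) => x y.
have q_nz : q != 0 by rewrite qE mulf_neq0.
apply: (mulIf q_nz); rewrite [LHS]mulrC eqS !mulrDl !divzK // mulrC {1}qE -mulrA.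
rewrite -nu_carry // -/(t x) -/(t y) -(raddfB chi) -/(t (x - y)) opprB subr0.
by ring.
Qed.

(** * Lines as level sets of linear forms, and incidence counts *)

Lemma det_mx22 {R : comPzRingType} (M : 'M[R]_2) :
  \det M = M 0 0 * M 1 1 - M 0 1 * M 1 0.
Proof.
have l1 : lift 0 (0 : 'I_1) = 1 :> 'I_2 by apply: val_inj.
have l0 : lift 1 (0 : 'I_1) = 0 :> 'I_2 by apply: val_inj.
rewrite (expand_det_row _ 0) !big_ord_recl big_ord0 /cofactor !det_mx11 !mxE.
by rewrite !(l1, l0) /=; ring.
Qed.

Lemma sum2E {V : nmodType} (f : 'I_2 -> V) : \sum_i f i = f 0 + f 1.
Proof.
rewrite !big_ord_recl big_ord0 addr0; congr (_ + f _).
exact: val_inj.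
Qed.

(* The lines with direction [d] are the level sets of the linear form
   [lform d]. *)
Definition normal_x {F : finFieldType} (d : direction F) : F :=
  if d is Some e then - e else 1.

Definition normal_y {F : finFieldType} (d : direction F) : F :=
  if d is Some _ then 1 else 0.

Definition lform {F : finFieldType} (d : direction F) (P : point F) : F :=
  normal_x d * xcoord P + normal_y d * ycoord P.

(** Determinant of the two normal vectors. *)
Definition bracket {F : finFieldType} (d e : direction F) : F :=
  normal_x d * normal_y e - normal_y d * normal_x e.

Lemma in_points {F : finFieldType} (d : direction F) (b : F) (P : point F) :
  (P \in points (d, b)) = (lform d P == b).
Proof.
case: d => [d|]; rewrite inE /lform /=; last by rewrite mul1r mul0r addr0.
by rewrite mul1r mulNr [in RHS]addrC subr_eq [in RHS]addrC.
Qed.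

Lemma bracket_neq0 {F : finFieldType} (d e : direction F) :
  d != e -> bracket d e != 0.
Proof.
case: d e => [d|] [e|] //; rewrite /bracket /= !(mul1r, mulr1, mul0r, mulr0).
- by rewrite (inj_eq Some_inj) opprK addrC subr_eq0 eq_sym.
- by rewrite sub0r oppr_eq0 oner_eq0.
- by rewrite subr0 oner_eq0.
Qed.

Lemma point_eq {F : finFieldType} (P Q : point F) :
  xcoord P = xcoord Q -> ycoord P = ycoord Q -> P = Q.
Proof.
move=> eqx eqy; apply/matrixP => i j; rewrite ord1.
by case: (unliftP 0 i) => [k|] -> //; rewrite ord1 (_ : lift _ _ = 1) //;
  apply: val_inj.
Qed.

(** The line joining [P] and [Q] is vertical if their first coordinates agree, and has slope [s]
    otherwise. *)
Lemma card_joining_dirs {F : finFieldType} (P Q : point F) :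
  P != Q -> #|[set d | lform d Q == lform d P]| = 1%N.
Proof.
move=> neqPQ; have neq0 : (xcoord P != xcoord Q) || (ycoord P != ycoord Q).
  apply: contraR neqPQ; rewrite negb_or !negbK => /andP[/eqP eqx /eqP eqy].
  by apply/eqP/point_eq.
case: (eqVneq (xcoord P) (xcoord Q)) neq0 => [eqx neqy|neqx _].
  rewrite -(cards1 (None : direction F)); apply: eq_card => -[d|].
    rewrite !inE /lform /= eqx !mul1r (inj_eq (addrI _)) eq_sym.
    exact: negbTE.
  by rewrite !inE /lform /= eqx !mul0r !eqxx.
have dx : xcoord P - xcoord Q != 0 by rewrite subr_eq0.
pose s := (ycoord P - ycoord Q) / (xcoord P - xcoord Q).
rewrite -(cards1 (Some s : direction F)); apply: eq_card => -[d|]; last first.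
  by rewrite !inE /lform /= !mul0r !mul1r !addr0 eq_sym (negbTE neqx).
rewrite !inE (inj_eq Some_inj) /lform /= !mul1r /s.
rewrite -[RHS](inj_eq (mulIf dx)) divfK // -[LHS]subr_eq0 -[RHS]subr_eq0.
by congr (_ == _); ring.
Qed.

(** In the double sum [P] is counted for each of the [q + 1] directions, and every other point
    exactly once. *)
Lemma sum_lines_through {F : finFieldType} (S : multiset F) (P : point F) :
  \sum_d meet_size S (d, lform d P) = #|F|%:Z * S P + \sum_Q S Q.
Proof.
have -> : \sum_d meet_size S (d, lform d P) =
    \sum_Q S Q *+ #|[set d | lform d Q == lform d P]|.
  rewrite /meet_size; under eq_bigr => d _ do rewrite big_mkcond /=.
  rewrite exchange_big /=; apply: eq_bigr => Q _.
  rewrite -big_mkcond /= sumr_const; congr (_ *+ _).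
  by apply: eq_card => d; rewrite !inE; exact: in_points.
rewrite (bigD1 P) //= [in RHS](bigD1 P) //= addrA.
under eq_bigr => Q neqQP do rewrite card_joining_dirs 1?eq_sym //.
congr (_ + _).
have -> : #|[set d | lform d P == lform d P]| = #|F|.+1.
  by rewrite -card_option -cardsT; apply: eq_card => d; rewrite !inE eqxx.
by rewrite mulrS addrC -mulr_natl natz.
Qed.

Lemma equidistributedE {F : finFieldType} (S : multiset F) (d : direction F) b :
  equidistributed S d -> meet_size S (d, b) = meet_size S (d, 0).
Proof.
by move/forallP/(_ (d, b))/forallP/(_ (d, 0)); rewrite eqxx => /eqP.
Qed.

Lemma three_direction_sum {F : finFieldType} (S : multiset F) :
    #|[set d : direction F | inequidistributed S d]| = 3%N ->
  exists (d1 d2 d3 : direction F) (k : int),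
    [/\ d1 != d2, d2 != d3, d3 != d1 & forall P, #|F|%:Z * S P =
     meet_size S (d1, lform d1 P) + meet_size S (d2, lform d2 P)
     + meet_size S (d3, lform d3 P) + k].
Proof.
set D := [set d | _] => cardD.
have : size (enum D) = 3%N by rewrite -cardE.
have := enum_uniq D; case eqD: (enum D) => [|d1 [|d2 [|d3 [|]]]] //= uniqD _.
(* The last witness collects the equidistributed directions and absorbs the total size of [S]. *)
exists d1, d2, d3, (\sum_(d | d \notin D) meet_size S (d, 0) - \sum_Q S Q).
move: uniqD; rewrite !inE negb_or => /and3P[/andP[n12 n13] n23 _].
split=> // [|P]; first by rewrite eq_sym.
apply: (addIr (\sum_Q S Q)); rewrite -sum_lines_through (bigID (mem D)) /=.
rewrite -big_enum eqD /= !big_cons big_nil addr0 !addrA subrK; congr (_ + _).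
by apply: eq_bigr => d; rewrite inE negbK => /equidistributedE.
Qed.

(** * Normalizing the three directions *)

Lemma linear_perm {F : finFieldType} (M : 'M[F]_2) :
  M \in unitmx -> exists phi : {perm point F}, forall v, phi v = M *m v.
Proof.
move=> uM; have injM : injective (fun v : point F => M *m v).
  by apply: (can_inj (g := mulmx (invmx M))) => v; rewrite mulKmx.
by exists (perm injM) => v; rewrite permE.
Qed.

(** Each summand is constant along the lines of one of the three directions, so its values serve as
    the coefficients of those lines. *)
Lemma in_ZL_three {F : finFieldType} (a b c : F -> int) :
  in_ZL [set None; Some 0; Some 1]
    [ffun P : point F =>
       a (xcoord P) + b (ycoord P) + c (ycoord P - xcoord P)].
Proof.
pose coef (l : line F) :=
  match l.1 with
  | None => a l.2
  | Some d => if d == 0 then b l.2 else c l.2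
  end.
exists coef; apply/ffunP => P; rewrite !ffunE.
have sum_dir (d : direction F) :
    \sum_u coef (d, u) * mu_set (points (d, u)) P = coef (d, lform d P).
  rewrite (bigD1 (lform d P)) //= big1 => [|u neq_u]; rewrite ffunE in_points.
    by rewrite eqxx mulr1 addr0.
  by rewrite eq_sym (negbTE neq_u) mulr0.
transitivity (\sum_(d in [set None; Some 0; Some 1])
    \sum_u coef (d, u) * mu_set (points (d, u)) P); last first.
  rewrite pair_big_dep; apply: eq_big => [l|[d u] _] //.
  by rewrite /= andbT.
under eq_bigr do rewrite sum_dir.
rewrite -setUA big_setU1 ?big_setU1 ?big_set1 ?inE /=.
- rewrite /coef /lform /= eqxx oner_eq0 oppr0 !(mul1r, mul0r, addr0, add0r).
  by rewrite mulN1r addrA [- _ + _]addrC.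
- by rewrite (inj_eq Some_inj) eq_sym oner_eq0.
- by [].
Qed.

(* With [alpha = - [d2 d3]], [beta = [d3 d1]] and [gamma = - [d1 d2]] the three
   linear forms satisfy [beta lform_2 - alpha lform_1 = gamma lform_3], so the
   coordinates [(alpha lform_1, beta lform_2)] send the exceptional directions
   to (oo), (0), (1). *)
Lemma normalizing_coordinates {F : finFieldType} (d1 d2 d3 : direction F) :
    d1 != d2 -> d2 != d3 -> d3 != d1 ->
  exists (M : 'M[F]_2) (alpha beta gamma : F),
    [/\ M \in unitmx, [&& alpha != 0, beta != 0 & gamma != 0] &
     forall P, [/\ xcoord (M *m P) = alpha * lform d1 P,
                   ycoord (M *m P) = beta * lform d2 P &
                   ycoord (M *m P) - xcoord (M *m P) = gamma * lform d3 P]].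
Proof.
move=> n12 n23 n31.
pose alpha := - bracket d2 d3; pose beta := bracket d3 d1.
pose M : 'M[F]_2 := \matrix_(i, j)
  if i == 0 then alpha * (if j == 0 then normal_x d1 else normal_y d1)
  else beta * (if j == 0 then normal_x d2 else normal_y d2).
have eqx (P : point F) : xcoord (M *m P) = alpha * lform d1 P.
  by rewrite mxE sum2E !mxE /= /lform; ring.
have eqy (P : point F) : ycoord (M *m P) = beta * lform d2 P.
  by rewrite mxE sum2E !mxE /= /lform; ring.
exists M, alpha, beta, (- bracket d1 d2); split; last 1 first.
- move=> P; split=> //.
  by rewrite eqx eqy /alpha /beta /lform /bracket; ring.
- rewrite unitmxE unitfE det_mx22 !mxE /=.
  have -> : alpha * normal_x d1 * (beta * normal_y d2) -
    alpha * normal_y d1 * (beta * normal_x d2) = alpha * beta * bracket d1 d2.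
    by rewrite /bracket; ring.
  by rewrite !mulf_neq0 ?oppr_eq0 ?bracket_neq0.
- by rewrite !oppr_eq0 !bracket_neq0.
Qed.

(** * The two cases of the classification *)

Theorem theorem4p6 (p h : nat) (F : finFieldType)
    (p_prime : prime p) (cardF : #|F| = (p ^ h)%N)
    (S : multiset F)
    (S_three : #|[set d : direction F | inequidistributed S d]| = 3%N) :
  exists phi : {perm point F},
    is_affine phi /\
    (in_ZL [set None; Some 0; Some 1] (image_multiset S phi) \/
     exists g : multiset F,
       in_ZL [set None; Some 0; Some 1] g /\
       image_multiset S phi = mu_set (Lift F p h (setK p)) + g).
Proof.
have [d1 [d2 [d3 [k [n12 n23 n31 eqS]]]]] := three_direction_sum S S_three.
have [M [al [be [ga [uM /and3P[al0 be0 ga0] coordM]]]]] :=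
  normalizing_coordinates d1 d2 d3 n12 n23 n31.
have h_gt0 : (0 < h)%N.
  by case: h cardF => // cardF; have := card_finNzRing_gt1 F; rewrite cardF.
have cardFE : #|F| = (p ^ h.-1 * p)%N by rewrite -expnSr prednK.
have pcharF : p \in [pchar F] := card_finPcharP cardF p_prime.
have pF0 (u : F) : u *+ p = 0 by rewrite -mulr_natr (pcharf0 pcharF) mulr0.
pose S' x y := S (invmx M *m \col_i (if i == 0 then x else y)).
have S'E P : S P = S' (xcoord (M *m P)) (ycoord (M *m P)).
  rewrite /S'; congr (S _); rewrite -[LHS](mulKmx uM); congr (_ *m _).
  by apply: point_eq; rewrite [RHS]mxE.
(* The normalized coordinates and their difference are [al], [be], [ga] times the linear forms,
   whence the divisions. *)
have [||chi [a [b [c S'abc]]]] := @three_function_sum p (p ^ h.-1) F S'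
  (fun x => meet_size S (d1, x / al)) (fun y => meet_size S (d2, y / be))
  (fun z => meet_size S (d3, z / ga)) k p_prime _ pF0.
- by rewrite expn_gt0 prime_gt0.
- move=> x y; rewrite -cardFE /S'; set P := invmx M *m _.
  have [eqx eqy eqz] := coordM P; rewrite eqS.
  have MP : M *m P = \col_i (if i == 0 then x else y) by rewrite mulKVmx.
  rewrite MP !mxE /= in eqx eqy eqz.
  by rewrite eqz eqx eqy ![_ * lform _ _]mulrC !mulfK.
have [x0 tr0] := absTr_neq0 p_prime cardF.
pose tr : {additive F -> 'F_p} := HB.pack (@absTr F p h)
  (GRing.isZmodMorphism.Build _ _ _ (absTr_additive p_prime cardF)).
have [l chiE] := additive_dual tr chi x0 p_prime tr0.
have [l0|l_nz] := eqVneq l 0.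
  have [phi phiE] := linear_perm M uM; exists phi; split.
    by exists M, 0; split=> // v; rewrite addr0.
  left; have -> : image_multiset S phi = [ffun P : point F =>
       a (xcoord P) + b (ycoord P) + c (ycoord P - xcoord P)].
    apply/ffunP => P; rewrite !ffunE S'E -phiE permKV S'abc !chiE l0 !mul0r.
    by rewrite ltnn add0r.
  exact: in_ZL_three.
(* Replacing [M] by [l *: M] turns the trace of [l * x] into the trace of the new coordinate; [a],
   [b], [c] must then divide their arguments by [l]. *)
have ulM : l *: M \in unitmx by rewrite unitmxZ ?unitfE.
have [phi phiE] := linear_perm (l *: M) ulM; exists phi; split.
  by exists (l *: M), 0; split=> // v; rewrite addr0.
right; exists [ffun P : point F => a (xcoord P / l) + b (ycoord P / l)
                 + c ((ycoord P - xcoord P) / l)]; split.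
  exact: (in_ZL_three (fun x => a (x / l)) (fun x => b (x / l))
                      (fun x => c (x / l))).
apply/ffunP => P; rewrite !ffunE S'E; set Q := (phi^-1)%g P.
have -> : M *m Q = l^-1 *: P.
  by rewrite -[P](permKV phi) phiE -scalemxAl scalerA mulVf // scale1r.
rewrite S'abc !chiE !mxE -!addrA -mulrBr ![l^-1 * _]mulrC; congr (_ + _).
by rewrite !inE !mxE !(mulrC l) !divfK.
Qed.
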